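(* If $G$ is a cograph whose normalized cotree has $r$ bags (i.e. has bag representation $\{B_i^{t_i}\}_{i=1}^r$), then $G$ has at most $r$ main $\mathbf{Q}$-eigenvalues.
   Context: All graphs are finite and simple. A cograph is a $P_4$-free graph; it is represented by a rooted tree (cotree) whose leaves are the vertices and whose internal nodes are labeled $\cup$ (disjoint union) or $\oplus$ (join), two vertices being adjacent iff their lowest common ancestor is labeled $\oplus$. The cotree is normalized if every internal node has at least two children and a label different from its parent's. A bag is the set of all leaf children of an internal node; the bag representation $\{B_i^{t_i}\}_{i=1}^r$ lists the $r$ bags $B_i$ with $t_i=|B_i|$, and $r$ is the width of the cotree. $\mathbf{Q}(G)=\mathbf{D}(G)+\mathbf{A}(G)$ is the signless Laplacian matrix; an eigenvalue of $\mathbf{Q}(G)$ is main if its eigenspace is not orthogonal to the all-ones vector, and the number of main $\mathbf{Q}$-eigenvalues counts distinct such eigenvalues. *)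

(* Defs.v *)
From mathcomp Require Import all_boot all_order all_algebra.

Set Implicit Arguments.
Unset Strict Implicit.
Unset Printing Implicit Defensive.

Import GRing.Theory.
Local Open Scope ring_scope.

(* A finite simple graph is a symmetric irreflexive relation e on V : finType. *)

Definition p4_free (V : finType) (e : rel V) : Prop :=
  forall a b c d : V, uniq [:: a; b; c; d] ->
    ~~ [&& e a b, e b c, e c d, ~~ e a c, ~~ e a d & ~~ e b d].

(* The Boolean label of an internal node is true for a join node and false for
   a disjoint-union node.  The order of the children carries no meaning. *)
Inductive cotree (V : Type) : Type :=
| Leaf of V
| Node of bool & seq (cotree V).

Section Cotree.
Variable V : finType.
Implicit Types (T : cotree V) (n : bool * seq (cotree V)).

Fixpoint leaves T : seq V :=
  match T with
  | Leaf v => [:: v]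
  | Node _ ts => flatten (map leaves ts)
  end.

(* Each internal node is listed as its label paired with its child subtrees. *)
Fixpoint internal_nodes T : seq (bool * seq (cotree V)) :=
  match T with
  | Leaf _ => [::]
  | Node b ts => (b, ts) :: flatten (map internal_nodes ts)
  end.

Definition is_lca n (x y : V) : bool :=
  [&& x \in flatten (map leaves n.2), y \in flatten (map leaves n.2)
    & ~~ has (fun t => (x \in leaves t) && (y \in leaves t)) n.2].

Definition cotree_adj T (x y : V) : bool :=
  has (fun n => is_lca n x y && n.1) (internal_nodes T).

Definition represents T (e : rel V) : Prop :=
  [/\ uniq (leaves T), forall v : V, v \in leaves T
    & forall x y : V, x != y -> e x y = cotree_adj T x y].

Definition normalized T : bool :=
  all (fun n => (1 < size n.2)%N &&
         all (fun t => if t is Node b _ then b != n.1 else true) n.2)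
      (internal_nodes T).

Definition leaf_children n : {set V} :=
  [set v | has (fun t => if t is Leaf u then u == v else false) n.2].

(* Internal nodes without leaf children contribute no bag.  The cotree of the
   one-vertex graph has no internal node; by convention its vertex forms a
   single bag, so that the bags always partition the vertex set. *)
Definition bags T : seq {set V} :=
  match T with
  | Leaf v => [:: [set v]]
  | Node _ _ => [seq B <- map leaf_children (internal_nodes T) | B != set0]
  end.

End Cotree.

(* Rows and columns are indexed by the canonical enumeration of V. *)
Section SignlessLaplacian.
Variables (R : rcfType) (V : finType) (e : rel V).

Definition adjacency_mx : 'M[R]_#|V| :=
  \matrix_(i, j) (e (enum_val i) (enum_val j))%:R.

Definition degree_mx : 'M[R]_#|V| :=
  diag_mx (\row_i #|[set w | e (enum_val i) w]|%:R).

Definition signless_laplacian : 'M[R]_#|V| := degree_mx + adjacency_mx.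

End SignlessLaplacian.

(* eigenspace M a consists of row vectors; for symmetric M these are the
   transposes of the usual column eigenvectors. *)
Definition main_eigenvalue (R : rcfType) (n : nat) (M : 'M[R]_n) (a : R) : bool :=
  eigenvalue M a && (eigenspace M a *m (const_mx 1 : 'cV[R]_n) != 0).

(* Main.v *)
Require Import Defs.
From mathcomp Require Import all_boot all_order all_algebra.
From mathcomp Require Import all_fingroup polyrcf.

(** Two leaves in the same bag are twins, so exchanging them is an automorphism
    of the graph that fixes every bag.  Hence the bags form an equitable
    partition: if [S] is the vertex-bag incidence matrix, then [Q S = S B] for
    some [r * r] matrix [B], and [S 1 = 1].  If [u Q = a u] and [u 1 <> 0], then
    [(u S) B = a (u S)] and [(u S) 1 = u 1 <> 0], so [a] is one of the at most
    [r] roots of the characteristic polynomial of [B]. *)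

Set Implicit Arguments.
Unset Strict Implicit.
Unset Printing Implicit Defensive.

Import GRing.Theory.
Local Open Scope ring_scope.

(** * Main eigenvalues and quotient matrices *)

Lemma main_eigenvalue_quotient (R : rcfType) n r (Q : 'M[R]_n)
    (S : 'M[R]_(n, r)) (B : 'M[R]_r) a :
  Q *m S = S *m B -> S *m const_mx 1 = const_mx 1 :> 'cV[R]_n ->
  main_eigenvalue Q a -> root (char_poly B) a.
Proof.
move=> QS S1 /andP[_ /eqP nz]; rewrite -eigenvalue_root_char.
(* A main eigenvalue must have a single eigenvector with nonzero sum: if every spanning row of the
   eigenspace were orthogonal to the all-ones vector, so would be the whole eigenspace. *)
case: (boolP [forall i, row i (eigenspace Q a) *m (const_mx 1 : 'cV[R]_n) == 0]).
  move=> /forallP z; case: nz; apply/row_matrixP => i.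
  by rewrite row_mul row0; apply/eqP.
rewrite negb_forall => /existsP[i]; set u := row i _ => un0.
have uQ : u *m Q = a *: u by apply/eigenspaceP; apply: row_sub.
apply/eigenvalueP; exists (u *m S); first by rewrite -mulmxA -QS mulmxA uQ scalemxAl.
by apply: contra un0 => /eqP uS0; rewrite -S1 mulmxA uS0 mul0mx.
Qed.

Lemma main_eigenvalues_quotient (R : rcfType) n r (Q : 'M[R]_n)
    (S : 'M[R]_(n, r)) (B : 'M[R]_r) :
  Q *m S = S *m B -> S *m const_mx 1 = const_mx 1 :> 'cV[R]_n ->
  exists s : seq R, [/\ uniq s, s =i main_eigenvalue Q & (size s <= r)%N].
Proof.
move=> QS S1; have p_neq0 := monic_neq0 (char_poly_monic B).
exists [seq a <- rootsR (char_poly B) | main_eigenvalue Q a]; split.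
- exact/filter_uniq/uniq_roots.
- move=> a; rewrite mem_filter -[a \in main_eigenvalue Q]/(main_eigenvalue Q a).
  apply: andb_idr => am.
  by rewrite -(roots_on_rootsR p_neq0) in_itv (main_eigenvalue_quotient QS S1 am).
(* The size of a polynomial is its degree plus one, here [r.+1], and strictly bounds the number of
   distinct roots. *)
- rewrite -ltnS -(size_char_poly B); apply: max_poly_roots => //.
    apply/allP => a; rewrite mem_filter => /andP[_].
    by rewrite -(roots_on_rootsR p_neq0) => /andP[].
  exact/filter_uniq/uniq_roots.
Qed.

(** * Twin classes form an equitable partition *)

Section Twins.
Variables (V : finType) (e : rel V).
Hypotheses (e_sym : symmetric e) (e_irr : irreflexive e).

Definition twins x y := forall z, z != x -> z != y -> e x z = e y z.

(** A third vertex sees [x] and [y] alike, and the pair [x], [y] itself is only reversed, which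
    symmetry absorbs. *)
Lemma twins_tperm x y a b :
  twins x y -> e (tperm x y a) (tperm x y b) = e a b.
Proof.
move=> tw.
case: (tpermP x y a) => [->|->|/eqP ax /eqP ay];
  case: (tpermP x y b) => [->|->|/eqP bx /eqP b_y] //;
  rewrite ?e_irr ?(e_sym a) ?tw // e_sym //.
Qed.

Lemma twins_degree x y : twins x y -> #|[set w | e x w]| = #|[set w | e y w]|.
Proof.
move=> tw; rewrite -(card_imset [set w | e x w] (@perm_inj _ (tperm x y))).
apply: eq_card => w; rewrite -[w in LHS](tpermK x y) mem_imset ?inE; last exact: perm_inj.
by rewrite -(twins_tperm x _ tw) tpermL tpermK.
Qed.

Variables (R : rcfType) (r : nat) (f : V -> 'I_r).

Definition class_mx : 'M[R]_(#|V|, r) :=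
  \matrix_(i, k) (f (enum_val i) == k)%:R.

Lemma class_mx_mul m (B : 'M[R]_(r, m)) i k :
  (class_mx *m B) i k = B (f (enum_val i)) k.
Proof.
rewrite mxE (bigD1 (f (enum_val i))) //= mxE eqxx mul1r big1 ?addr0 // => j ji.
by rewrite mxE eq_sym (negPf ji) mul0r.
Qed.

(** Summing over vertices instead of matrix indices lets a permutation of [V] reindex the sum. *)
Lemma mul_class_mx i k :
  (signless_laplacian R e *m class_mx) i k =
  \sum_w (#|[set w | e (enum_val i) w]|%:R *+ (enum_val i == w)
          + (e (enum_val i) w)%:R) * (f w == k)%:R.
Proof.
rewrite mxE (reindex _ (onW_bij _ (enum_rank_bij V))) /=.
apply: eq_bigr => w _; rewrite !mxE enum_rankK.
by rewrite -(inj_eq enum_val_inj) enum_rankK.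
Qed.

Hypothesis f_twins : forall x y, f x = f y -> twins x y.

Lemma mul_class_mx_eq i j k : f (enum_val i) = f (enum_val j) ->
  (signless_laplacian R e *m class_mx) i k =
  (signless_laplacian R e *m class_mx) j k.
Proof.
rewrite !mul_class_mx; move: (enum_val i) (enum_val j) => x y fxy.
have tw := f_twins fxy.
(* Swapping [x] and [y] turns the sum for [y] into the sum for [x]: degrees, the diagonal test and
   adjacency are preserved by the automorphism, and classes because [f x = f y]. *)
rewrite [RHS](reindex_inj (@perm_inj _ (tperm x y))).
apply: eq_bigr => w _ /=; rewrite (twins_degree tw).
rewrite -(twins_tperm x w tw) tpermL.
rewrite -(inj_eq (@perm_inj _ (tperm x y)) x w) tpermL.
by congr (_ * (_ == _)%:R); case: tpermP => [->|->|].
Qed.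

Lemma class_mx_equitable :
  exists B : 'M[R]_r, signless_laplacian R e *m class_mx = class_mx *m B.
Proof.
(* Row [k] of [B] is copied from any representative of class [k]. The default 0 fills the rows of
   empty classes, while the class of a given [i] always contains [i]. *)
exists (\matrix_(k, l) if [pick i | f (enum_val i) == k] is Some i
  then (signless_laplacian R e *m class_mx) i l else 0).
apply/matrixP => i k; rewrite class_mx_mul [in RHS]mxE.
case: pickP => [j /eqP fj|/(_ i)]; last by rewrite eqxx.
exact: mul_class_mx_eq.
Qed.

Lemma class_mx_const1 : class_mx *m const_mx 1 = const_mx 1 :> 'cV[R]_#|V|.
Proof. by apply/matrixP => i k; rewrite class_mx_mul !mxE. Qed.

End Twins.

(** * Induction on cotrees and the position of a leaf *)

Lemma cotree_nested_ind V (P : cotree V -> Prop) :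
  (forall v, P (Leaf v)) ->
  (forall b ts, (forall ts1 t ts2, ts = ts1 ++ t :: ts2 -> P t) ->
     P (Node b ts)) ->
  forall T, P T.
Proof.
move=> Pleaf Pnode.
have Pnil ts1 t ts2 : [::] = ts1 ++ t :: ts2 -> P t by case: ts1.
(* The inner induction on the child list exposes each child as a structural subterm, so that [IH] is
   guarded. Splitting the list, rather than membership, avoids equality tests on trees and keeps the
   siblings at hand. *)
fix IH 1 => -[v|b ts]; first exact: Pleaf.
apply: Pnode; elim: ts => [|t0 ts IHts] ts1 t ts2; first exact: Pnil.
case: ts1 => [|t1 ts1] [].
  by move=> <- _; exact: IH.
move=> _; exact: IHts.
Qed.

Lemma has_splitP (T : Type) (p : pred T) s :
  has p s -> exists s1 t s2, s = s1 ++ t :: s2 /\ p t.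
Proof.
elim: s => //= t s IH /orP[pt|/IH[s1 [u [s2 [-> pu]]]]].
  by exists [::], t, s.
by exists (t :: s1), u, s2.
Qed.

Lemma has_flatten_map (S T : Type) (p : pred T) (g : S -> seq T) s :
  has p (flatten (map g s)) = has (fun t => has p (g t)) s.
Proof. by elim: s => //= t s IH; rewrite has_cat IH. Qed.

Lemma all_flatten_map (S T : Type) (p : pred T) (g : S -> seq T) s :
  all p (flatten (map g s)) = all (fun t => all p (g t)) s.
Proof. by elim: s => //= t s IH; rewrite all_cat IH. Qed.

Section CotreeBags.
Variable V : finType.
Implicit Types (T t : cotree V) (ts : seq (cotree V)).

Lemma mem_flatten_leaves v ts :
  (v \in flatten (map (@leaves V) ts)) = has (fun t => v \in leaves t) ts.
Proof.
rewrite -has_pred1 has_flatten_map; apply: eq_has => t; exact: has_pred1.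
Qed.

Lemma internal_nodes_notin v T : v \notin leaves T ->
  all (fun n => v \notin flatten (map (@leaves V) n.2)) (internal_nodes T).
Proof.
elim/cotree_nested_ind: T => //= b ts IH vts; rewrite vts all_flatten_map /=.
move: vts; rewrite mem_flatten_leaves; apply: contraR; rewrite -has_predC.
move=> /has_splitP[ts1 [t [ts2 [ets /= nt]]]]; rewrite ets has_cat /=.
by rewrite (contraR (IH _ _ _ ets) nt) orbT.
Qed.

Lemma leaf_children_leaves v n :
  v \in leaf_children n -> v \in flatten (map (@leaves V) n.2).
Proof.
rewrite inE mem_flatten_leaves; apply: sub_has => -[u|//].
by rewrite inE eq_sym.
Qed.

Lemma has_leaf_children_leaves v T :
  has (fun n => v \in leaf_children n) (internal_nodes T) -> v \in leaves T.
Proof.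
apply: contraTT => /internal_nodes_notin vT; rewrite -all_predC.
by apply: sub_all vT => n; apply: contra; apply: leaf_children_leaves.
Qed.

Lemma uniq_leaves_split v ts1 t ts2 :
  uniq (flatten (map (@leaves V) (ts1 ++ t :: ts2))) -> v \in leaves t ->
  all (fun t => v \notin leaves t) ts1 && all (fun t => v \notin leaves t) ts2.
Proof.
rewrite map_cat flatten_cat /= cat_uniq has_cat negb_or cat_uniq.
move=> /and3P[_ /andP[/hasPn d1 _] /and3P[_ /hasPn d2 _]] vt.
rewrite -[all _ ts1]negbK -[all _ ts2]negbK -!has_predC.
have eN us : has (predC (fun t => v \notin leaves t)) us
    = (v \in flatten (map (@leaves V) us)).
  by rewrite mem_flatten_leaves; apply: eq_has => u /=; rewrite negbK.
rewrite !eN (d1 _ vt) /=; apply/negP => /d2; by rewrite /= vt.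
Qed.

(** * Two leaves of one bag are not separated by the cotree *)

Section SameBag.
Variables x y : V.

(* Leaves are exempt because no leaf contains [z] together with [x] or [y]
   when [z] differs from both. *)
Definition nonsep t :=
  if t is Leaf _ then true else (x \in leaves t) == (y \in leaves t).

Definition nonsep_node (n : bool * seq (cotree V)) :=
  ((x \in flatten (map (@leaves V) n.2)) ==
   (y \in flatten (map (@leaves V) n.2))) && all nonsep n.2.

Lemma nonsep_notin t : x \notin leaves t -> y \notin leaves t -> nonsep t.
Proof. by case: t => // b ts; rewrite /nonsep => /negPf-> /negPf->. Qed.

Lemma nonsep_node_notin n : x \notin flatten (map (@leaves V) n.2) ->
  y \notin flatten (map (@leaves V) n.2) -> nonsep_node n.
Proof.
move=> xn yn; rewrite /nonsep_node (negPf xn) (negPf yn) /=.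
move: xn yn; rewrite !mem_flatten_leaves -!all_predC => xn yn.
have: all (predI (fun t => x \notin leaves t) (fun t => y \notin leaves t)) n.2.
  by rewrite all_predI xn.
by apply: sub_all => t /andP[]; apply: nonsep_notin.
Qed.

Lemma nonsep_nodes_notin t : x \notin leaves t -> y \notin leaves t ->
  all nonsep_node (internal_nodes t).
Proof.
move=> /internal_nodes_notin xt /internal_nodes_notin yt.
have: all (predI (fun n => x \notin flatten (map (@leaves V) n.2))
    (fun n => y \notin flatten (map (@leaves V) n.2))) (internal_nodes t).
  by rewrite all_predI xt.
by apply: sub_all => n /andP[]; apply: nonsep_node_notin.
Qed.

Lemma leaf_child_notin v b ts1 c us ts2 :
  let ts := ts1 ++ Node c us :: ts2 in
  uniq (flatten (map (@leaves V) ts)) -> v \in leaf_children (b, ts) ->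
  v \notin leaves (Node c us).
Proof.
move=> ts uts; rewrite inE => vn; apply/negP => vt.
have /andP[v1 v2] := uniq_leaves_split uts vt.
move: vn; rewrite has_cat /=; apply/negP; rewrite negb_or -!all_predC.
by apply/andP; split; [apply: sub_all v1|apply: sub_all v2] => -[u|//] /=;
  rewrite inE eq_sym.
Qed.

(** Let [p] be the node whose bag holds [x] and [y]. A node above [p] has both in the same child,
    [p] has them as exempt leaf children, and by uniqueness of leaves every other node contains
    neither. *)
Lemma same_bag_nonsep T : uniq (leaves T) ->
  has (fun n => (x \in leaf_children n) && (y \in leaf_children n))
    (internal_nodes T) ->
  all nonsep_node (internal_nodes T).
Proof.
elim/cotree_nested_ind: T => //= b ts IH uts /orP[/andP[xb yb]|].
  (* The root is [p]: its non-leaf children miss both vertices. *)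
  have nts : all (fun t => if t is Node _ _ then
      (x \notin leaves t) && (y \notin leaves t) else true) ts.
    rewrite -[all _ _]negbK -has_predC; apply/negP.
    move=> /has_splitP[ts1 [t [ts2 [ets]]]]; case: t ets => //= c us ets.
    rewrite ets in uts xb yb.
    by rewrite (leaf_child_notin uts xb) (leaf_child_notin uts yb).
  rewrite {1}/nonsep_node /= !(leaf_children_leaves (n := (b, ts))) //=.
  rewrite all_flatten_map -all_predI.
  apply: sub_all nts => -[//|c us] /andP[xt yt] /=.
  apply/andP; split; first exact: (nonsep_notin xt yt).
  exact: (nonsep_nodes_notin xt yt).
(* Here [p] lies inside the child [t]: induction treats [t], and its siblings contain neither
   vertex. *)
rewrite has_flatten_map => /has_splitP[ts1 [t [ts2 [ets ht]]]].
have ut : uniq (leaves t).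
  move: uts; rewrite ets map_cat flatten_cat /= !cat_uniq.
  by case/and3P=> _ _ /and3P[].
have [xt yt] : x \in leaves t /\ y \in leaves t.
  by split; apply: has_leaf_children_leaves; apply: sub_has ht => n /andP[].
have allt := IH _ _ _ ets ut ht; rewrite ets in uts *.
have /andP[x1 x2] := uniq_leaves_split uts xt.
have /andP[y1 y2] := uniq_leaves_split uts yt.
have other us : all (fun t => x \notin leaves t) us ->
    all (fun t => y \notin leaves t) us ->
    all nonsep us && all (fun t => all nonsep_node (internal_nodes t)) us.
  move=> xu yu; rewrite -all_predI.
  have: all (predI (fun t => x \notin leaves t) (fun t => y \notin leaves t)) us.
    by rewrite all_predI xu.
  apply: sub_all => u /andP[xu' yu'] /=.
  by rewrite nonsep_notin ?nonsep_nodes_notin.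
have /andP[n1 n1'] := other _ x1 y1; have /andP[n2 n2'] := other _ x2 y2.
rewrite all_flatten_map all_cat /= n1' allt n2' andbT.
rewrite /nonsep_node /= !mem_flatten_leaves !has_cat /= xt yt !orbT eqxx /=.
rewrite all_cat /= n1 n2 andbT.
by case: {+}t xt yt => //= c us -> ->.
Qed.

Lemma nonsep_is_lca n z : nonsep_node n -> z != x -> z != y ->
  is_lca n x z = is_lca n y z.
Proof.
move=> /andP[/eqP xy nn] zx zy; rewrite /is_lca xy; congr [&& _, _ & ~~ _].
elim: n.2 nn => //= t ts IH /andP[nt /IH->]; congr (_ || _).
(* A leaf child [u] contains [z] only if [u] is [z], and then it contains neither [x] nor [y]. *)
case: t nt => [u _|b us /eqP->] //=; rewrite !inE.
by case: (z =P u) => [<-|]; rewrite ?andbF // eq_sym (negPf zx) eq_sym (negPf zy).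
Qed.

Lemma same_bag_cotree_adj T z : uniq (leaves T) ->
  has (fun n => (x \in leaf_children n) && (y \in leaf_children n))
    (internal_nodes T) -> z != x -> z != y ->
  cotree_adj T x z = cotree_adj T y z.
Proof.
move=> uT /(same_bag_nonsep uT); rewrite /cotree_adj => nT zx zy.
elim: (internal_nodes T) nT => //= n ns IH /andP[nn /IH->].
by rewrite (nonsep_is_lca nn zx zy).
Qed.

End SameBag.

(** * Bags consist of twins and cover the vertices *)

Lemma bags_twins T (e : rel V) (B : {set V}) x y : represents T e ->
  B \in bags T -> x \in B -> y \in B -> twins e x y.
Proof.
case=> uT _ adjT; case: T uT adjT => [v _ _|b ts uT adjT].
  by rewrite inE => /eqP->; rewrite !inE => /eqP-> /eqP->.
rewrite mem_filter => /andP[_ Bn] xB yB z zx zy.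
rewrite !adjT 1?eq_sym //; apply: same_bag_cotree_adj => //.
(* The bag [B] comes from some internal node, which then has both [x] and [y] as leaf children. *)
elim: (internal_nodes _) Bn => //= n ns IH; rewrite inE => /orP[/eqP eB|/IH->].
  by rewrite -eB xB yB.
by rewrite orbT.
Qed.

(** The node sought is the parent of the leaf [v]. A bare leaf has no internal node, hence the
    trivial branch. *)
Lemma leaves_has_leaf_children T v : v \in leaves T ->
  if T is Node _ _ then
    has (fun n => v \in leaf_children n) (internal_nodes T)
  else true.
Proof.
elim/cotree_nested_ind: T => // b ts IH; rewrite [leaves _]/= mem_flatten_leaves.
move=> /has_splitP[ts1 [t [ts2 [ets vt]]]]; rewrite /= has_flatten_map.
case: t ets vt => [u|c us] ets vt.
  by move: vt; rewrite !inE /= ets has_cat /= eq_sym => ->; rewrite orbT.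
have /= ht := IH _ _ _ ets vt.
by apply/orP; right; rewrite ets has_cat /= ht orbT.
Qed.

Lemma has_bags T v : v \in leaves T -> has (fun B : {set V} => v \in B) (bags T).
Proof.
case: T => [u|b ts]; first by rewrite /= !inE => ->.
move=> /leaves_has_leaf_children; rewrite /bags.
elim: (internal_nodes _) => //= n ns IH.
(* Discarding empty bags loses no vertex. *)
case: (eqVneq (leaf_children n) set0) => [->|_] /=.
  by rewrite in_set0; exact: IH.
by case/orP=> [->|/IH->] //; rewrite orbT.
Qed.

End CotreeBags.

Theorem theorem2 (R : rcfType) (V : finType) (e : rel V)
  (e_sym : symmetric e) (e_irr : irreflexive e) (e_cograph : p4_free e)
  (T : cotree V) (T_repr : represents T e) (T_norm : normalized T)
  (r : nat) (T_bags : size (bags T) = r) :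
  exists s : seq R,
    [/\ uniq s,
        forall a : R, (a \in s) = main_eigenvalue (signless_laplacian R e) a
      & (size s <= r)%N].
Proof.
have hasT v : has (fun B : {set V} => v \in B) (bags T).
  by apply: has_bags; case: T_repr.
have lt_r v : (find (fun B : {set V} => v \in B) (bags T) < r)%N.
  by rewrite -T_bags -has_find.
(* [f v] is the position of the first bag containing [v], so equal values of [f] mean a common
   bag. *)
pose f v := Ordinal (lt_r v).
have f_twins x y : f x = f y -> twins e x y.
  case=> fxy; apply: (bags_twins T_repr (B := nth set0 (bags T) (f x))).
  - by rewrite mem_nth ?T_bags.
  - exact: (nth_find set0 (hasT x)).
  - by rewrite /= fxy; exact: (nth_find set0 (hasT y)).
have [B QS] := class_mx_equitable e_sym e_irr R f_twins.
exact: main_eigenvalues_quotient QS (class_mx_const1 R f).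
Qed.
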